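(* Let $k<n$ be non-negative integers. Let $G$ be an $n$-vertex multigraph and $D$ a monotone non-homotopic drawing of $G$. (a) If each pair of edges cross at most $k$ times in $D$, then $|E(G)| \leq 2\binom{2n}{k+1}$. (b) If each pair of incident edges cross at most $k$ times in $D$, then $|E(G)| \leq n\binom{2n}{k+1}$. (c) If each pair of parallel edges cross at most $k$ times in $D$, then $|E(G)| \leq n(n-1)\binom{2n}{k+1}$.
   Context: A multigraph may have parallel edges and loops. A drawing $\phi$ of a multigraph $G$ maps each vertex $v$ to a distinct point $\phi_v\in\mathbb{R}^2$ and each edge $e=vw$ to a continuous curve $\phi_e\colon[0,1]\to\mathbb{R}^2$ with endpoints $\phi_v,\phi_w$ whose interior avoids all vertex images, with finitely many crossings, where a crossing is an unordered pair of distinct pairs $(e,s),(f,t)\in E(G)\times(0,1)$ with $\phi_e(s)=\phi_f(t)$. Two parallel edges $e,f$ with end-vertices $v,w$ are homotopic if there is a homotopy in $\mathbb{R}^2\setminus\{\phi_x: x\in V(G)\setminus\{v,w\}\}$ taking $\phi_e$ to $\phi_f$ with endpoints fixed; the drawing is non-homotopic if no two parallel edges are homotopic. The drawing is monotone if every edge is an x-monotone curve, i.e. meets every vertical line in at most one point (so there are no loops). Two edges are incident if they share at least one end-vertex. *)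

(* Defs.v *)
From HB Require Import structures.
From mathcomp Require Import all_boot all_order all_algebra.
From mathcomp Require Import all_classical all_reals all_analysis.
Set Implicit Arguments.
Unset Strict Implicit.
Unset Printing Implicit Defensive.
Import Order.TTheory GRing.Theory Num.Theory.
Import numFieldNormedType.Exports.
Local Open Scope classical_set_scope.
Local Open Scope ring_scope.

(* An edge has one end-vertex when it is a loop, two otherwise. *)
Record multigraph := Multigraph {
  vertex : finType;
  edge : finType;
  ends : edge -> {set vertex};
  card_ends : forall e, (0 < #|ends e| <= 2)%N
}.

Definition parallel (G : multigraph) (e f : edge G) : Prop := ends e = ends f.

Definition incident (G : multigraph) (e f : edge G) : Prop :=
  exists v : vertex G, v \in ends e /\ v \in ends f.

Section Crossings.
Variables (R : realType) (E : finType) (curve : E -> R -> R * R).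

(* The crossings {(e,s), (f,t)} between e and f; self-crossings when e = f. *)
Definition crossings_between (e f : E) : set (set (E * R)) :=
  [set c | exists s t : R,
    [/\ 0 < s < 1, 0 < t < 1, (e, s) <> (f, t), curve e s = curve f t &
        c = [set (e, s); (f, t)]]].

Definition crossings : set (set (E * R)) :=
  [set c | exists e f : E, crossings_between e f c].

End Crossings.

(* Only the restriction of [curve e] to [0, 1] is meaningful. Edges are not
   oriented, so [curve e] may run in either direction between its ends. *)
Record drawing (R : realType) (G : multigraph) := Drawing {
  vpoint : vertex G -> R * R;
  curve : edge G -> R -> R * R;
  vpoint_inj : injective vpoint;
  curve_continuous : forall e, {within `[0, 1], continuous (curve e)};
  curve_ends : forall e,
    [set curve e 0; curve e 1] = vpoint @` [set v | v \in ends e];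
  curve_interior : forall e v t, 0 < t < 1 -> curve e t <> vpoint v;
  finite_crossings : finite_set (crossings curve)
}.

Definition cross_at_most (R : realType) (G : multigraph) (D : drawing R G)
    (k : nat) (e f : edge G) : Prop :=
  (crossings_between (curve D) e f #<= `I_k)%card.

(* The two cases for [H (1, _)] account for the two possible directions of
   [curve D f] relative to [curve D e]. *)
Definition homotopic (R : realType) (G : multigraph) (D : drawing R G)
    (e f : edge G) : Prop :=
  exists H : R * R -> R * R,
    [/\ {within `[0, 1] `*` `[0, 1], continuous H},
        (forall t, 0 <= t <= 1 -> H (0, t) = curve D e t),
        (forall t, 0 <= t <= 1 -> H (1, t) = curve D f t) \/
        (forall t, 0 <= t <= 1 -> H (1, t) = curve D f (1 - t)),
        (forall s, 0 <= s <= 1 ->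
           H (s, 0) = curve D e 0 /\ H (s, 1) = curve D e 1) &
        (forall s t, 0 <= s <= 1 -> 0 <= t <= 1 ->
           forall x, x \notin ends e -> H (s, t) <> vpoint D x)].

Definition non_homotopic (R : realType) (G : multigraph) (D : drawing R G) :
    Prop :=
  forall e f : edge G, e <> f -> parallel e f -> ~ homotopic D e f.

Definition x_monotone (R : realType) (G : multigraph) (D : drawing R G) : Prop :=
  forall (e : edge G) (a : R) (p q : R * R),
    (curve D e @` `[0, 1]) p -> (curve D e @` `[0, 1]) q ->
    p.1 = a -> q.1 = a -> p = q.

(* Main.v *)
Require Import Defs.
From HB Require Import structures.
From mathcomp Require Import all_boot all_order all_algebra.
From mathcomp Require Import all_classical all_reals all_analysis.
From mathcomp Require Import zify ring lra.

(** Read every edge from left to right as the word recording, at each vertex in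
    its range, whether it passes below, ends at, or passes above that vertex.
    Two edges with the same word are homotopic through curves lying between
    them, so the words are distinct; and each sign change in the comparison of
    two words forces a crossing.  Hence it suffices to bound the number of
    distinct words no two of which alternate [k + 2] times.  Merging the two
    leftmost vertices gives a Sauer-Shelah type recursion for this number, whose
    solution is at most [2 * 'C(2 * n, k + 1)].  Parts (b) and (c) follow by
    applying this to the edges at each vertex and to each parallel class. *)
Set Implicit Arguments.
Unset Strict Implicit.
Unset Printing Implicit Defensive.

(** * Words and their alternations *)

(* The letters [Some 0], [Some 1] and [Some 2] mean that the edge passes below,
   ends at, or passes above the vertex; [None] that the vertex is outside its
   range.  [started] words belong to edges whose left end has been merged into
   the vertices already read, [waiting] words to edges still to begin. *)
Definition letter_lt (s : bool) (a b : option nat) : bool :=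
  if (a, b) is (Some i, Some j) then if s then i < j else j < i else false.

(** Some [d] positions, read left to right, carry strict comparisons of alternating direction, the
    first with [u] below [w] when [s] is true. *)
Fixpoint alternates (u w : seq (option nat)) (d : nat) (s : bool) : bool :=
  if d is d'.+1 then
    if (u, w) is (a :: u', b :: w') then
      alternates u' w' d s || letter_lt s a b && alternates u' w' d' (~~ s)
    else false
  else true.

Lemma alternates0 u w s : alternates u w 0 s.
Proof. by case: u. Qed.

Lemma alternates_cons a b u w d s :
  alternates (a :: u) (b :: w) d.+1 s =
    alternates u w d.+1 s || letter_lt s a b && alternates u w d (~~ s).
Proof. by []. Qed.

Lemma alternatesxx u d s : alternates u u d.+1 s = false.
Proof.
elim: u d s => //= a u IH d s; rewrite IH /= /letter_lt.
by case: a => [i|] //; case: s; rewrite ltnn.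
Qed.

Fixpoint started (w : seq (option nat)) : bool :=
  if w is a :: w' then
    (a == Some 1) && all (pred1 None) w'
    || ((a == Some 0) || (a == Some 2)) && started w'
  else false.

Fixpoint waiting (w : seq (option nat)) : bool :=
  if w is a :: w' then
    (a == None) && waiting w' || (a == Some 1) && started w'
  else false.

(** The recursion behind [word_count], where no two words alternate [d.+1] times: one term for the
    merged words, two for the repeated tails, and one exceptional word. *)
Fixpoint word_bound (N d : nat) : nat :=
  if N is N'.+1 then
    if d is d'.+1 then (word_bound N' d + 2 * word_bound N' d').+1 else 1
  else 0.

Lemma started_not_blank w : started w -> all (pred1 None) w = false.
Proof. by case: w => [|[[|[|[|i]]]|] w] //=; case: eqP. Qed.

Lemma blankE w : all (pred1 None) w -> w = nseq (size w) (None : option nat).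
Proof. by move/all_pred1P. Qed.

Lemma started_not_waiting w : started w -> waiting w = false.
Proof.
case: w => [|a w] //= /orP[/andP[/eqP-> bw]|/andP[/orP[]/eqP-> _]] //=.
by apply/negP => /started_not_blank; rewrite bw.
Qed.

(** Before the first difference neither word has met [Some 1], after which only blanks follow; so
    both letters there are of the form [Some _] and can be compared. *)
Lemma started_distinct u w : started u -> started w -> size u = size w ->
  u <> w -> exists s, alternates u w 1 s.
Proof.
elim: u w => [|a u IH] [|b w] //= su sw [suw] neq.
have [eab|/eqP nab] := eqVneq a b; last first.
  case: a b su sw nab {neq} => [i|] [j|] //= su sw nab.
  have [ij|ji|eij] := ltngtP i j; last by case: nab; rewrite eij.
    by exists true; rewrite /= /letter_lt ij alternates0 orbT.
  by exists false; rewrite /= /letter_lt ji alternates0 orbT.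
subst b; have {}neq : u <> w by move=> uw; apply: neq; rewrite uw.
case/orP: su => /andP[].
  move=> /eqP ea /blankE eu; case/orP: sw => /andP[]; last by rewrite ea.
  by move=> _ /blankE ew; case: neq; rewrite eu ew suw.
move=> ha su; case/orP: sw => /andP[]; first by move=> /eqP ea; rewrite ea in ha.
move=> _ sw; have [s hs] := IH w su sw suw neq.
by exists s; rewrite hs.
Qed.

(** * Counting words by deleting the first letter *)

Definition tails (a : option nat) (F : seq (seq (option nat))) :=
  [seq behead w | w <- F & (w != [::]) && (ohead w == Some a)].

Lemma mem_tails a F w : (w \in tails a F) = (a :: w \in F).
Proof.
apply/mapP/idP => [[[|b v]]|aw].
- by rewrite mem_filter.
- by rewrite mem_filter /= => /andP[/eqP[->]] ? ->.
- by exists (a :: w); rewrite // mem_filter /= eqxx.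
Qed.

Lemma tails_uniq a F : uniq F -> uniq (tails a F).
Proof.
move=> uF; rewrite map_inj_in_uniq ?filter_uniq// => -[|b u] [|c w];
  rewrite !mem_filter //= => /andP[/eqP[->] _] /andP[/eqP[->] _] -> //.
Qed.

Lemma size_filterD (T : eqType) (A B : seq T) :
  size A = size [seq x <- A | x \in B] + size [seq x <- A | x \notin B].
Proof. by rewrite !size_filter -[LHS](count_predC (mem B)). Qed.

(* Deleting the first letter merges the two leftmost vertices.  A tail t loses
   at most two words; prescribing the deleted letters at will makes any two
   tails of [top] (or of [bottom]) alternate once more. *)
Lemma word_count N d (F : seq (seq (option nat))) :
  uniq F ->
  {in F, forall w, size w = N} ->
  {in F, forall w, started w || waiting w} ->
  (d = 0 -> {in F, forall w, started w}) ->
  (forall u w s, u \in F -> w \in F -> ~~ alternates u w d.+1 s) ->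
  size F <= word_bound N d.
Proof.
elim: N d F => [|N IH] d F uF sF wF dF aF.
  case: F uF sF wF dF aF => // w F _ sF wF _ _.
  have w_in : w \in w :: F by rewrite mem_head.
  by move: (wF _ w_in) (sF _ w_in) => /[swap] /size0nil ->.
case: d dF aF => [|d] dF aF.
  (* With no alternation allowed, two distinct started words would contradict [started_distinct]. *)
  move: dF => /(_ erefl) stF.
  case: F uF sF wF stF aF => // u [//|w F] uF sF _ stF aF.
  have u_in : u \in [:: u, w & F] by rewrite mem_head.
  have w_in : w \in [:: u, w & F] by rewrite !inE eqxx orbT.
  have neq : u <> w by move=> uw; move: uF; rewrite /= uw inE eqxx.
  have suw : size u = size w by rewrite !sF.
  have [s hs] := started_distinct (stF _ u_in) (stF _ w_in) suw neq.
  by have := aF u w s u_in w_in; rewrite hs.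
pose T0 := tails (Some 0) F; pose T2 := tails (Some 2) F.
pose T1 := [seq w <- tails (Some 1) F | started w]; pose TN := tails None F.
(* [merged] keeps one copy of each tail; the repeats of started tails are collected in [top] and
   [bottom]. *)
pose low := [seq w <- T0 | w \notin T1].
pose high := [seq w <- T2 | w \notin T0 ++ T1].
pose top := [seq w <- T2 | w \in T0 ++ T1].
pose bottom := [seq w <- T0 | w \in T1].
pose merged := TN ++ T1 ++ low ++ high.
have T1F w : w \in T1 -> Some 1 :: w \in F.
  by rewrite mem_filter mem_tails => /andP[].
have st1 w : w \in T1 -> started w by rewrite mem_filter => /andP[].
have st0 w : w \in T0 -> started w.
  by rewrite mem_tails => /wF; rewrite /= orbF.
have st2 w : w \in T2 -> started w.
  by rewrite mem_tails => /wF; rewrite /= orbF.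
have waN w : w \in TN -> waiting w.
  by rewrite mem_tails => /wF; rewrite /= orbF.
have mergedF w : w \in merged -> exists a, a :: w \in F.
  rewrite !mem_cat => /orP[|/orP[|/orP[]]].
  - by rewrite mem_tails; exists None.
  - by move/T1F; exists (Some 1).
  - by rewrite mem_filter mem_tails => /andP[_]; exists (Some 0).
  - by rewrite mem_filter mem_tails => /andP[_]; exists (Some 2).
have szF a w : a :: w \in F -> size w = N by move=> /sF [].
have Fsize : size F <= (size TN + (size T1 + (size T0 + size T2))).+1.
  (* The extra word belongs to an edge already begun that ends at this vertex; its blank tail is
     neither started nor waiting. *)
  pose F' := (Some 1 :: nseq N None) :: ([seq None :: w | w <- TN]
     ++ [seq Some 1 :: w | w <- T1] ++ [seq Some 0 :: w | w <- T0]
     ++ [seq Some 2 :: w | w <- T2]).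
  have <- : size F' = (size TN + (size T1 + (size T0 + size T2))).+1.
    by rewrite /= !size_cat !size_map.
  apply: uniq_leq_size => // -[|a w] wF'; first by have := sF _ wF'.
  rewrite inE !mem_cat; case: a wF' => [[|[|[|i]]]|] wF'.
  - by rewrite (map_f (cons (Some 0))) ?mem_tails// !orbT.
  - have := wF _ wF' => /=; rewrite orbF => /orP[/blankE->|sw].
      by rewrite (szF _ _ wF') eqxx.
    by rewrite (map_f (cons (Some 1))) ?orbT// mem_filter sw mem_tails.
  - by rewrite (map_f (cons (Some 2))) ?mem_tails// !orbT.
  - by have := wF _ wF'.
  - by rewrite (map_f (cons None)) ?mem_tails// !orbT.
have sizes : size TN + (size T1 + (size T0 + size T2))
    = size merged + size top + size bottom.
  rewrite (size_filterD T0 T1) (size_filterD T2 (T0 ++ T1)).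
  rewrite /merged !size_cat -/low -/high -/top -/bottom.
  by move: (size TN) (size T1) (size low) (size high) => ? ? ? ?; lia.
have topF w : w \in top ->
    [/\ started w, Some 2 :: w \in F &
     exists2 i, i < 2 & Some i :: w \in F].
  rewrite mem_filter mem_cat => /andP[h w2]; split; first exact: st2.
    by rewrite -mem_tails.
  case/orP: h; first by rewrite mem_tails; exists 0.
  by move=> /T1F; exists 1.
have bottomF w : w \in bottom ->
    [/\ started w, Some 1 :: w \in F & Some 0 :: w \in F].
  rewrite mem_filter => /andP[/[dup] w1 /T1F w1F w0].
  by split=> //; [exact: st1|rewrite -mem_tails].
have u0 : uniq T0 by apply: tails_uniq.
have u2 : uniq T2 by apply: tails_uniq.
have merged_le : size merged <= word_bound N d.+1.
  apply: IH => //.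
  - rewrite !cat_uniq !filter_uniq ?tails_uniq//= !andbT.
    apply/and3P; split; apply/hasPn => w; rewrite ?mem_cat.
    + move=> h; have sw : started w.
        case/orP: h => [/st1//|/orP[]]; rewrite mem_filter => /andP[_].
          exact: st0.
        exact: st2.
      by apply/negP => /= /waN; rewrite started_not_waiting.
    + case/orP; first by rewrite mem_filter => /andP[].
      by rewrite mem_filter mem_cat negb_or => /andP[/andP[]].
    + rewrite mem_filter mem_cat negb_or => /andP[/andP[w0 _] _] /=.
      by rewrite mem_filter (negbTE w0) andbF.
  - by move=> w /mergedF[a /szF].
  - move=> w; rewrite !mem_cat => /orP[/waN->|]; first by rewrite orbT.
    case/orP => [/st1->//|/orP[]]; rewrite mem_filter => /andP[_].
      by move=> /st0->.
    by move=> /st2->.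
  - move=> u w s /mergedF[a au] /mergedF[b bw].
    by have /= := aF _ _ s au bw; rewrite negb_or => /andP[].
(* The new first comparison is chosen opposite to [s]. Since [d] may now be 0, it matters that these
   tails are all started. *)
have top_le : size top <= word_bound N d.
  apply: IH => //.
  - by rewrite filter_uniq.
  - by move=> w /topF[_ /szF].
  - by move=> w /topF[->].
  - by move=> _ w /topF[->].
  - move=> u w s /topF[_ u2F [i i2 uiF]] /topF[_ w2F [j j2 wjF]].
    case: s.
      by have := aF _ _ false u2F wjF; rewrite alternates_cons /letter_lt j2 negb_or
        => /andP[].
    by have := aF _ _ true uiF w2F; rewrite alternates_cons /letter_lt i2 negb_or
        => /andP[].
have bottom_le : size bottom <= word_bound N d.
  apply: IH => //.
  - by rewrite filter_uniq.
  - by move=> w /bottomF[_ /szF].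
  - by move=> w /bottomF[->].
  - by move=> _ w /bottomF[->].
  - move=> u w s /bottomF[_ u1F u0F] /bottomF[_ w1F w0F].
    case: s.
      by have := aF _ _ false u1F w0F; rewrite alternates_cons negb_or
        => /andP[].
    by have := aF _ _ true u0F w1F; rewrite alternates_cons negb_or
        => /andP[].
rewrite /=; lia.
Qed.

(** * Solving the recursion with binomial coefficients *)

Lemma word_bound_exp N d : 2 * word_bound N d < 3 ^ N.
Proof.
(* If [M] bounds the values at [N] for all [d], then [3 * M + 1] bounds those at [N.+1]. *)
elim: N d => [|N IH] [|d] //=; have := IH 0.
  by have := expn_gt0 3 N; rewrite expnS; lia.
by have := IH d.+1; have := IH d; rewrite expnS; lia.
Qed.

Lemma exp3_central_bin n : 3 ^ n <= 4 * 'C(2 * n, n).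
Proof.
elim: n => [|[|n] IH] //.
(* The ratio of these consecutive central binomials is 4 - 2/(n+2), hence at least 3. *)
suff : 3 * 'C(2 * n.+1, n.+1) <= 'C(2 * n.+2, n.+2) by rewrite expnS; lia.
have e : 2 * n.+2 = (2 * n.+1).+2 by lia.
have := mul_bin_left (2 * n.+1) n.
have -> : 2 * n.+1 - n = n.+2 by lia.
have h : 'C(2 * n.+1, n.+2) = 'C(2 * n.+1, n).
  by rewrite -bin_sub; [congr binomial|]; lia.
move: (2 * n.+1) e h => m -> h; rewrite !binS h; nia.
Qed.

(** Pascal's rule applied twice gives C(2n+2,d) = C(2n,d) + 2C(2n,d-1) + C(2n,d-2), which matches
    the recursion, the last term absorbing its added 1. *)
Lemma word_bound_bin n d : 0 < d <= n -> word_bound n d <= 2 * 'C(2 * n, d).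
Proof.
elim: n d => [|n IH] [|d] //.
rewrite ltnS => /andP[_]; rewrite leq_eqVlt => /orP[/eqP ->|dn].
  (* On the diagonal the induction hypothesis does not apply, so the bound uniform in [d] is
     used. *)
  have := word_bound_exp n.+1 n.+1; have := exp3_central_bin n.+1; lia.
have -> : 2 * n.+1 = (2 * n).+2 by lia.
have /= h1 := IH d.+1 dn.
case: d dn h1 => [|d] dn h1.
  by rewrite /= !bin1 in h1 *; case: n dn {IH} h1 => //= n; lia.
have h2 := IH d.+1 (ltnW dn).
have : 0 < 'C(2 * n, d) by rewrite bin_gt0; lia.
rewrite !binS /=; lia.
Qed.

(** * Continuity, clamping and reorientation *)

Section Geometry.
Import Order.TTheory GRing.Theory Num.Theory.
Import numFieldNormedType.Exports.
Local Open Scope classical_set_scope.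
Local Open Scope ring_scope.

Lemma continuous_comp_within (T S U : topologicalType) (A : set S)
    (h : T -> S) (f : S -> U) :
  continuous h -> (forall t, A (h t)) -> {within A, continuous f} ->
  continuous (f \o h).
Proof.
move=> hc hA /subspace_continuousP fc t W Wf.
have near_t : nbhs t (h @^-1` [set x | A x -> W (f x)]).
  exact: (hc t _ (fc _ (hA t) _ Wf)).
by apply: filterS near_t => u /=; apply.
Qed.

Lemma infinite_open_itv (R : realType) (a b : R) : a < b ->
  infinite_set `]a, b[.
Proof.
move=> ab; apply/infiniteP/card_subP.
(* The denominator [n.+2] keeps every point strictly inside the interval. *)
exists (range (fun n : nat => a + (b - a) / n.+2%:R)).
  apply: inj_card_eq => m n _ _ /addrI /mulfI.
  rewrite subr_eq0 gt_eqF// => /(_ isT) /invr_inj /eqP.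
  by rewrite eqr_nat => /eqP [].
move=> _ [n _ <-] /=; rewrite in_itv /=.
have ab0 : 0 < b - a by lra.
rewrite ltrDl divr_gt0//= -ltrBrDl ltr_pdivrMr ?ltr0n//.
by rewrite ltr_pMr// ltr1n.
Qed.

(** Composing with it turns continuity on [[a, b]] into continuity everywhere, without changing
    values on [[a, b]]. *)
Definition clamp (R : realType) (a b t : R) : R := Num.max a (Num.min t b).

Lemma clamp_itv (R : realType) (a b t : R) : a <= b -> a <= clamp a b t <= b.
Proof. by move=> ab; rewrite /clamp le_max lexx ge_max ab ge_min lexx orbT. Qed.

Lemma clamp_id (R : realType) (a b t : R) : a <= t <= b -> clamp a b t = t.
Proof. by move=> /andP[at_ tb]; rewrite /clamp (min_idPl tb) (max_idPr at_). Qed.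

Lemma clamp_continuous (R : realType) (a b : R) : continuous (clamp a b).
Proof.
move=> t; apply: (@continuous_max _ _ (cst a) (id \min cst b)).
  exact: cst_continuous.
by apply: continuous_min; [exact: cvg_id|exact: cst_continuous].
Qed.

Definition orient (R : realType) (b : bool) (t : R) : R :=
  if b then 1 - t else t.

Lemma orient_continuous (R : realType) b : continuous (@orient R b).
Proof.
case: b => t; last exact: cvg_id.
by apply: continuousB; [exact: cst_continuous|exact: cvg_id].
Qed.

Lemma orient_cc (R : realType) b (t : R) :
  (0 <= orient b t <= 1) = (0 <= t <= 1).
Proof. by case: b => //=; apply/idP/idP; lra. Qed.

Lemma orient_oo (R : realType) b (t : R) : (0 < orient b t < 1) = (0 < t < 1).
Proof. by case: b => //=; apply/idP/idP; lra. Qed.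

Lemma orientK (R : realType) b : involutive (@orient R b).
Proof. by case: b => // t; rewrite /=; ring. Qed.

Lemma within_continuous_fst (R : realType) (A : set R) (f : R -> R * R) :
  {within A, continuous f} -> {within A, continuous (fun t => (f t).1)}.
Proof. by move=> fc t; apply: (cvg_comp _ _ (fc t)); exact: cvg_fst. Qed.

Lemma continuous_fst (R : realType) (T : topologicalType) (f : T -> R * R) :
  continuous f -> continuous (fun t => (f t).1).
Proof. by move=> fc t; apply: (cvg_comp _ _ (fc t)); exact: cvg_fst. Qed.

Lemma continuous_snd (R : realType) (T : topologicalType) (f : T -> R * R) :
  continuous f -> continuous (fun t => (f t).2).
Proof. by move=> fc t; apply: (cvg_comp _ _ (fc t)); exact: cvg_snd. Qed.

Lemma continuous_pair (R : realType) (T : topologicalType) (f g : T -> R) :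
  continuous f -> continuous g -> continuous (fun t => (f t, g t)).
Proof. by move=> fc gc t; exact: (cvg_pair (fc t) (gc t)). Qed.

(** * Monotone edges as graphs of functions *)

Section Edge.
Variables (R : realType) (G : multigraph) (D : drawing R G).
Hypothesis monoD : x_monotone D.

(** Monotonicity turns equal abscissae into equal points, hence into self-crossings; these are
    finitely many, each involving two parameters. *)
Lemma finite_self_meeting (e : edge G) : finite_set [set a : R | 0 < a < 1 /\
  exists b, [/\ 0 < b < 1, a <> b & (curve D e a).1 = (curve D e b).1]].
Proof.
have fin : finite_set (\bigcup_(c in crossings (curve D)) c).
  apply: bigcup_finite; first exact: finite_crossings.
  by move=> _ [? [? [s [t [_ _ _ _ ->]]]]]; exact: finite_set2.
apply: sub_finite_set (finite_image snd fin) => a [a01 [b [b01 ab eqx]]].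
exists (e, a) => //; exists [set (e, a); (e, b)]; last by left.
exists e, e, a, b; split=> //; first by move=> [].
by apply: (monoD _ _ erefl); rewrite ?eqx//; [exists a|exists b] => //=;
  rewrite in_itv/=; lra.
Qed.

(* If the x-coordinate took a value twice, the curve would have to run back
   along itself, creating infinitely many self-crossings. *)
Lemma curve_x_inj (e : edge G) :
  {in `[0, 1] &, injective (fun t => (curve D e t).1)}.
Proof.
pose g t := (curve D e t).1.
have gc : {within `[0, 1], continuous g}.
  by apply: within_continuous_fst; exact: curve_continuous.
suff lt_case s t : 0 <= s -> s < t -> t <= 1 -> g s = g t -> False.
  move=> s t; rewrite !in_itv/= => /andP[s0 s1] /andP[t0 t1] gst.
  by have [st|st|//] := ltgtP s t; exfalso;
    [apply: (lt_case s t)|apply: (lt_case t s)].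
move=> s0 st t1 gst.
set S := [set a : R | 0 < a < 1 /\
  exists b, [/\ 0 < b < 1, a <> b & (curve D e a).1 = (curve D e b).1]].
have finS : finite_set S by exact: finite_self_meeting.
have [[u [su ut gu]]|const] :=
    pselect (exists u, [/\ s < u, u < t & g u <> g s]); last first.
  have const' a : s < a < t -> g a = g s.
    move=> /andP[sa at_]; apply: contrapT => ga; apply: const.
    by exists a.
  (* On a constant stretch every parameter shares its abscissa with another one, here
     [(a + t) / 2]. *)
  apply: (infinite_open_itv st); apply: sub_finite_set finS => a /=.
  rewrite in_itv/= => /andP[sa at_]; split; first lra.
  exists ((a + t) / 2); split; [lra|lra|].
  by rewrite -/(g a) -/(g _) !const'//; lra.
have mM : Num.min (g s) (g u) < Num.max (g s) (g u).
  by move/eqP: gu; rewrite neq_lt lt_max !gt_min !ltxx /= orbF.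
(* By the intermediate value theorem, each value strictly between [g s] and [g u] is taken on both
   sides of [u]. *)
apply: (infinite_open_itv mM).
apply: sub_finite_set (finite_image g finS) => c.
rewrite /= in_itv/= => /andP[c1 c2].
have sub a b : 0 <= a -> b <= 1 -> {within `[a, b], continuous g}.
  move=> a0 b1; apply: continuous_subspaceW gc => x /=.
  by rewrite !in_itv/=; lra.
have [a] : exists2 a, a \in `[s, u] & g a = c.
  by apply: IVT; [lra|apply: sub; lra|rewrite !ltW].
rewrite in_itv/= => /andP[sa au] ga.
have [b] : exists2 b, b \in `[u, t] & g b = c.
  apply: IVT; [lra|apply: sub; lra|].
  by rewrite -gst minC maxC !ltW.
rewrite in_itv/= => /andP[ub bt] gb.
have [gsc guc] : g s <> c /\ g u <> c.
  by split=> gE; move: c1 c2; rewrite gt_min lt_max gE ltxx ?orbF /=; lra.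
have sa' : s < a.
  by rewrite lt_neqAle sa andbT; apply/eqP => sa'; apply: gsc; rewrite sa'.
have au' : a < u.
  by rewrite lt_neqAle au andbT; apply/eqP => au'; apply: guc; rewrite -au'.
have ub' : u < b.
  by rewrite lt_neqAle ub andbT; apply/eqP => ub'; apply: guc; rewrite ub'.
have bt' : b < t.
  by rewrite lt_neqAle bt andbT; apply/eqP => bt'; apply: gsc; rewrite gst -bt'.
exists a => //; split; first lra.
by exists b; split; [lra|lra|rewrite -/(g a) ga -gb].
Qed.

(* [graph_x] is the x-coordinate of the curve, run from left to right, and
   [graph_y] is the function whose graph is the curve. *)
Record edge_graph (e : edge G) := EdgeGraph {
  reversed : bool;
  graph_x : R -> R;
  graph_y : R -> R;
  left_end : vertex G;
  right_end : vertex G;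
  graph_x_continuous : continuous graph_x;
  graph_y_continuous : continuous graph_y;
  graph_x_mono : {in `[0, 1] &, {mono graph_x : s t / s <= t}};
  graph_curve : forall t, 0 <= t <= 1 ->
    curve D e (orient reversed t) = (graph_x t, graph_y (graph_x t));
  graph_left : curve D e (orient reversed 0) = vpoint D left_end;
  graph_right : curve D e (orient reversed 1) = vpoint D right_end;
  graph_ends : ends e = [set left_end; right_end]%SET
}.

Lemma edge_graph_exists (e : edge G) : exists _ : edge_graph e, True.
Proof.
(* The curve is reversed when it starts to the right of where it ends. *)
pose b := (curve D e 1).1 < (curve D e 0).1.
pose c := curve D e \o (fun t => orient b (clamp 0 1 t)).
have cE t : 0 <= t <= 1 -> c t = curve D e (orient b t).
  by move=> t01; rewrite /c /= clamp_id.
have c_continuous : continuous c.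
  apply: (continuous_comp_within _ _ (@curve_continuous _ _ D e)).
    move=> t; apply: (@continuous_comp _ _ _ (clamp 0 1) (orient b)).
      exact: clamp_continuous.
    exact: orient_continuous.
  by move=> t; rewrite /= in_itv/= orient_cc clamp_itv.
pose g t := (c t).1.
have gc : continuous g by exact: continuous_fst.
have g_inj : {in `[0, 1] &, injective g}.
  move=> s t; rewrite !in_itv/= => s01 t01; rewrite /g !cE// => /curve_x_inj.
  by rewrite !in_itv/= !orient_cc => /(_ s01 t01) /(can_inj (@orientK R b)).
have g01 : g 0 <= g 1.
  rewrite /g !cE ?lexx ?ler01// /orient /b.
  by case: ltP; rewrite ?subr0 ?subrr// => /ltW.
have g_mono : {in `[0, 1] &, {mono g : s t / s <= t}}.
  by apply: segment_continuous_inj_le => //; exact: continuous_subspaceT.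
(* [h] inverts [g] on [[g 0, g 1]] and is continuous there because [g] is increasing and continuous;
   clamping its argument makes [Y] continuous everywhere. *)
pose h x := xget 0 [set t | 0 <= t <= 1 /\ g t = x].
have gK : {in `[0, 1], cancel g h}.
  move=> t; rewrite in_itv/= => t01; rewrite /h.
  case: xgetP => [s _ [s01 gst]|/(_ t) []//].
  by apply: g_inj; rewrite ?in_itv.
have hc : {within `[g 0, g 1], continuous h}.
  by apply: segment_can_le_continuous => //; exact: continuous_subspaceT.
pose Y x := (c ((h \o clamp (g 0) (g 1)) x)).2.
have Yc : continuous Y.
  apply: continuous_snd => x.
  apply: (@continuous_comp _ _ _ (h \o clamp (g 0) (g 1)) c);
    last exact: c_continuous.
  apply: (continuous_comp_within _ _ hc); first exact: clamp_continuous.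
  by move=> t; rewrite /= in_itv/= clamp_itv.
have i0 : (0 : R) \in `[0, 1] by rewrite in_itv/= lexx ler01.
have i1 : (1 : R) \in `[0, 1] by rewrite in_itv/= lexx ler01.
have ends_pt (t : R) : t = 0 \/ t = 1 ->
    exists2 v, v \in ends e & vpoint D v = curve D e t.
  move=> h01; have : (vpoint D @` [set v | v \in ends e]) (curve D e t).
    by rewrite -curve_ends; case: h01 => ->; [left|right].
  by move=> [v ve <-]; exists v.
have [l le lE] : exists2 v, v \in ends e & vpoint D v = curve D e (orient b 0).
  by apply: ends_pt; rewrite /orient; case: ifP => _; [right; ring|left].
have [r re rE] : exists2 v, v \in ends e & vpoint D v = curve D e (orient b 1).
  by apply: ends_pt; rewrite /orient; case: ifP => _; [left; ring|right].
unshelve eexists (@EdgeGraph e b g Y l r gc Yc g_mono _ _ _ _) => //.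
- move=> t t01; have t_in : t \in `[0, 1] by rewrite in_itv.
  have gt01 : g 0 <= g t <= g 1 by rewrite !g_mono.
  by rewrite -cE// /Y /= clamp_id// gK// /g; case: (c t).
- apply/setP => v; rewrite !inE; apply/idP/orP => [ve|[]/eqP->//].
  have : [set curve D e 0; curve D e 1] (vpoint D v).
    by rewrite curve_ends; exists v.
  rewrite -(inj_eq (@vpoint_inj _ _ D) v l) -(inj_eq (@vpoint_inj _ _ D) v r).
  rewrite lE rE /orient; case: ifP => _.
    by rewrite subr0 subrr => -[]->; rewrite eqxx; [right|left].
  by move=> -[]->; rewrite eqxx; [left|right].
Qed.
End Edge.
Lemma convex_lt (R : realType) (s y z c : R) : 0 <= s <= 1 -> y < c -> z < c ->
  (1 - s) * y + s * z < c.
Proof. by move=> /andP[s0 s1] yc zc; have [yz|/ltW zy] := leP y z; nra. Qed.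

(** * The word of an edge *)

Section Words.
Variables (R : realType) (G : multigraph) (D : drawing R G).
Implicit Types (e f : edge G) (u v w : vertex G).
Local Notation px v := (vpoint D v).1.
Local Notation py v := (vpoint D v).2.

(** Lexicographic order; breaking ties by height makes it linear even when vertices share an
    abscissa. *)
Definition vle v w : bool := (px v < px w) || (px v == px w) && (py v <= py w).

Lemma vle_refl : reflexive vle.
Proof. by move=> v; rewrite /vle eqxx lexx orbT. Qed.

Lemma vle_total : total vle.
Proof. by move=> v w; rewrite /vle; case: ltgtP => //= _; exact: le_total. Qed.

Lemma vle_trans : transitive vle.
Proof.
move=> v u w /orP[uv|/andP[/eqP uv uv']] /orP[vw|/andP[/eqP vw vw']].
- by rewrite /vle (lt_trans uv vw).
- by rewrite /vle -vw uv.
- by rewrite /vle uv vw.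
- by rewrite /vle uv vw eqxx (le_trans uv' vw') orbT.
Qed.

Lemma vle_anti : antisymmetric vle.
Proof.
move=> v w; rewrite /vle; case: ltgtP => //= xvw /le_anti yvw.
by apply: (@vpoint_inj _ _ D); apply: injective_projections.
Qed.

Lemma vle_x v w : vle v w -> px v <= px w.
Proof. by move=> /orP[/ltW//|/andP[/eqP->]]. Qed.

Section Letters.
Variables (e : edge G) (a : edge_graph D e).
Local Notation l := (left_end a).
Local Notation r := (right_end a).

Lemma graph_left_xy : (graph_x a 0, graph_y a (px l)) = vpoint D l.
Proof.
by have := graph_left a; rewrite graph_curve ?lexx ?ler01// => <-.
Qed.

Lemma graph_right_xy : (graph_x a 1, graph_y a (px r)) = vpoint D r.
Proof.
by have := graph_right a; rewrite graph_curve ?lexx ?ler01// => <-.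
Qed.

Lemma graph_x0 : graph_x a 0 = px l.
Proof. by rewrite -[in RHS]graph_left_xy. Qed.

Lemma graph_x1 : graph_x a 1 = px r.
Proof. by rewrite -[in RHS]graph_right_xy. Qed.

Lemma left_lt_right : px l < px r.
Proof.
rewrite -graph_x0 -graph_x1.
by rewrite (leW_mono_in (graph_x_mono a)) ?ltr01// in_itv/= lexx ler01.
Qed.

Lemma graph_x_itv t : 0 <= t <= 1 -> px l <= graph_x a t <= px r.
Proof.
move=> t01; rewrite -graph_x0 -graph_x1 !graph_x_mono// in_itv/= ?lexx ?ler01//.
Qed.

Lemma graph_point x : px l <= x <= px r ->
  exists2 t, 0 <= t <= 1 & curve D e (orient (reversed a) t) = (x, graph_y a x).
Proof.
move=> xlr; have [||t] := @IVT _ (graph_x a) 0 1 x ler01.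
- by apply: continuous_subspaceT; exact: graph_x_continuous.
- by rewrite graph_x0 graph_x1 min_l ?max_r// ltW// left_lt_right.
- by rewrite in_itv/= => t01 <-; exists t; rewrite // graph_curve.
Qed.

Lemma graph_point_oo x : px l < x < px r ->
  exists2 t, 0 < t < 1 & curve D e t = (x, graph_y a x).
Proof.
move=> /andP[lx xr]; have [|t t01 ct] := @graph_point x; first by rewrite !ltW.
exists (orient (reversed a) t) => //; rewrite orient_oo.
have := ct; rewrite graph_curve// => -[gt _].
case/andP: t01 => t0 t1; rewrite !lt_neqAle t0 t1 !andbT.
apply/andP; split; apply/eqP => tE.
  by rewrite -gt -tE graph_x0 ltxx in lx.
by rewrite -gt tE graph_x1 ltxx in xr.
Qed.

(** Using [vle] makes the range an interval of the sorted vertex list, also on the vertical lines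
    through the two ends. *)
Definition in_range v : bool := vle l v && vle v r.

Definition letter v : option nat :=
  if in_range v then
    Some (if graph_y a (px v) < py v then 0%N
          else if graph_y a (px v) == py v then 1%N else 2%N)
  else None.

Lemma in_range_x v : in_range v -> px l <= px v <= px r.
Proof. by move=> /andP[/vle_x-> /vle_x->]. Qed.

Lemma in_range_oo v : px l < px v < px r -> in_range v.
Proof. by move=> /andP[lv vr]; rewrite /in_range /vle lv vr. Qed.

Lemma left_right : l != r.
Proof. by apply/eqP => lr; have := left_lt_right; rewrite lr ltxx. Qed.

Lemma vle_left_right : vle l r.
Proof. by rewrite /vle left_lt_right. Qed.

(** The interior of an edge avoids all vertices, so its graph meets a vertex only at an end. *)
Lemma ends_letter v : (v \in ends e) = (letter v == Some 1%N).
Proof.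
rewrite (graph_ends a) !inE /letter; apply/orP/idP.
  case=> /eqP->.
    have -> : in_range l by rewrite /in_range vle_refl vle_left_right.
    by rewrite -[in py l]graph_left_xy /= ltxx eqxx.
  have -> : in_range r by rewrite /in_range vle_refl vle_left_right.
  by rewrite -[in py r]graph_right_xy /= ltxx eqxx.
case: ifP => // /in_range_x /graph_point [t t01 ct].
case: ifP => // _; case: (eqVneq (graph_y a (px v))) => // yE _.
have {}ct : curve D e (orient (reversed a) t) = vpoint D v.
  by rewrite ct yE; case: (vpoint D v).
have [t0|nt0] := eqVneq t 0.
  by left; apply/eqP/(@vpoint_inj _ _ D); rewrite -ct t0 graph_left.
have [t1|nt1] := eqVneq t 1.
  by right; apply/eqP/(@vpoint_inj _ _ D); rewrite -ct t1 graph_right.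
have t01' : 0 < t < 1 by rewrite !lt_neqAle (eq_sym 0) nt0 nt1.
by case: (@curve_interior _ _ D e v (orient (reversed a) t)); rewrite ?orient_oo.
Qed.

Lemma letter_between v : in_range v -> v != l -> v != r ->
  letter v = Some 0%N \/ letter v = Some 2%N.
Proof.
move=> vr vl vr'; have := ends_letter v.
rewrite (graph_ends a) !inE (negbTE vl) (negbTE vr') /letter vr.
by case: ifP => [_|_]; [left|case: (eqVneq (graph_y a (px v))) => //; right].
Qed.

(** [s] stands for the vertices after [l]: those before [r] are passed strictly above or below,
    those after it are out of range. *)
Lemma started_word s : pairwise vle s -> uniq s -> r \in s ->
  all (vle l) s -> l \notin s -> started [seq letter v | v <- s].
Proof.
elim: s => //= v s IH /andP[vs ps] /andP[vNs us] rs /andP[lv ls].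
rewrite inE negb_or => /andP[lNv lNs].
have [vr|vNr] := eqVneq v r.
  have := ends_letter v; rewrite (graph_ends a) !inE vr eqxx orbT => /esym -> /=.
  apply/orP; left; apply/allP => _ /mapP[w ws ->] /=.
  rewrite /letter /in_range; case: andP => // -[_ wr]; exfalso.
  have /vle_anti wE : vle w v && vle v w by rewrite (allP vs) // vr wr.
  by rewrite -wE ws in vNs.
have {}rs : r \in s by move: rs; rewrite inE eq_sym (negbTE vNr).
have vR : in_range v by rewrite /in_range lv (allP vs).
by apply/orP; right; rewrite IH// andbT;
  case: (letter_between vR _ vNr); rewrite 1?eq_sym// => ->.
Qed.

Lemma waiting_word s : pairwise vle s -> uniq s -> l \in s -> r \in s ->
  waiting [seq letter v | v <- s].
Proof.
elim: s => //= v s IH /andP[vs ps] /andP[vNs us] ls rs.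
have [vl|vNl] := eqVneq v l.
  have := ends_letter v; rewrite (graph_ends a) !inE vl eqxx => /esym -> /=.
  rewrite started_word ?orbT// -?vl//.
  by move: rs; rewrite inE vl eq_sym (negbTE left_right).
have {}ls : l \in s by move: ls; rewrite inE eq_sym (negbTE vNl).
have vlel : vle v l by exact: (allP vs).
have [vr|vNr] := eqVneq v r.
  have /vle_anti lr : vle l r && vle r l by rewrite vle_left_right -vr.
  by have := left_right; rewrite lr eqxx.
have {}rs : r \in s by move: rs; rewrite inE eq_sym (negbTE vNr).
rewrite IH// andbT; apply/orP; left.
rewrite /letter /in_range; case: andP => // -[lv _].
have /vle_anti vE : vle l v && vle v l by rewrite lv.
by rewrite -vE eqxx in vNl.
Qed.
End Letters.

Lemma letter_lt_graph e f (a : edge_graph D e) (b : edge_graph D f) s v :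
  letter_lt s (letter a v) (letter b v) ->
  [/\ in_range a v, in_range b v &
   if s then graph_y a (px v) < graph_y b (px v)
   else graph_y b (px v) < graph_y a (px v)].
Proof.
rewrite /letter; case: (in_range a v) => //; case: (in_range b v) => // h.
split=> //; move: h; rewrite /letter_lt.
by case: s; case: (ltgtP (graph_y a _)) => ha;
  case: (ltgtP (graph_y b _)) => hb //;
  lra.
Qed.

(** * Alternations force crossings *)

Definition crosses_at e f (x : R) : Prop := exists s t,
  [/\ 0 < s < 1, 0 < t < 1, curve D e s = curve D f t & (curve D e s).1 = x].

(** The intermediate value theorem applies to the difference of the two graphs on a stretch covered
    by both edges; its strict signs at [v] and [w] place the zero in the interior of both. *)
Lemma crosses_between e f (a : edge_graph D e) (b : edge_graph D f) s v w :
  vle v w ->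
  letter_lt s (letter a v) (letter b v) ->
  letter_lt (~~ s) (letter a w) (letter b w) ->
  exists x, [/\ px v < x, x < px w & crosses_at e f x].
Proof.
move=> /vle_x vw.
move=> /letter_lt_graph[/in_range_x /andP[lav _] /in_range_x /andP[lbv _] hv].
move=> /letter_lt_graph[/in_range_x /andP[_ wra] /in_range_x /andP[_ wrb] hw].
pose h := graph_y a \- graph_y b.
have hc : continuous h.
  by move=> x; apply: continuousB; exact: graph_y_continuous.
have hvw : Num.min (h (px v)) (h (px w)) < 0 < Num.max (h (px v)) (h (px w)).
  rewrite gt_min lt_max /h /=.
  by case: s hv hw => /= hv hw; rewrite !subr_lt0 !subr_gt0 hv hw ?orbT.
have [||x] := @IVT _ h (px v) (px w) 0 vw.
- exact: continuous_subspaceT.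
- by case/andP: hvw => /ltW-> /ltW->.
rewrite in_itv/= => /andP[vx xw] /eqP; rewrite subr_eq0 => /eqP hx.
have vx' : px v < x.
  rewrite lt_neqAle vx andbT; apply/eqP => vE; move: hv.
  by rewrite vE hx; case: (s); rewrite ltxx.
have xw' : x < px w.
  rewrite lt_neqAle xw andbT; apply/eqP => wE; move: hw.
  by rewrite -wE hx; case: (~~ s); rewrite ltxx.
exists x; split=> //.
have [|p p01 pE] := @graph_point_oo e a x.
  by rewrite (le_lt_trans lav)// (lt_le_trans xw').
have [|q q01 qE] := @graph_point_oo f b x.
  by rewrite (le_lt_trans lbv)// (lt_le_trans xw').
by exists p, q; split; rewrite ?pE ?qE//= hx.
Qed.

(** Consecutive comparisons enclose crossings in successive intervals, so the abscissae increase.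
    Returning the first position [v] lets the induction prepend a crossing. *)
Lemma alternates_crosses e f (a : edge_graph D e) (b : edge_graph D f) s d vs :
  pairwise vle vs ->
  alternates (map (letter a) vs) (map (letter b) vs) d.+1 s ->
  exists v xs, [/\ v \in vs, letter_lt s (letter a v) (letter b v),
    size xs = d, path <%R (px v) xs & forall x, x \in xs -> crosses_at e f x].
Proof.
elim: vs s d => //= u vs IH s d /andP[us ps] /orP[/IH[]//|/andP[hu halt]].
  by move=> v [xs [v_in ? ? ? ?]]; exists v, xs; split=> //; rewrite inE v_in orbT.
case: d halt => [_|d /IH[]// v [xs [v_in hv sz pxs hxs]]].
  by exists u, [::]; rewrite mem_head.
have [x [ux xv hx]] := crosses_between (allP us _ v_in) hu hv.
exists u, (x :: xs); split; rewrite ?mem_head//= ?sz ?ux//=.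
  case: xs pxs {sz hxs} => //= y xs /andP[vy ->].
  by rewrite (lt_trans xv vy).
by move=> y; rewrite inE => /orP[/eqP->|/hxs].
Qed.

Lemma crosses_le e f k (xs : seq R) : e <> f -> cross_at_most D k e f ->
  uniq xs -> (forall x, x \in xs -> crosses_at e f x) -> (size xs <= k)%N.
Proof.
move=> ef cr uxs hxs; rewrite -card_le_II; apply: card_le_trans cr.
have /choice[c cP] : forall i, exists c : set (edge G * R), (i < size xs)%N ->
    crossings_between (curve D) e f c /\ exists s t,
      c = [set (e, s); (f, t)] /\ (curve D e s).1 = xs`_i.
  move=> i; have [ixs|] := ltnP i (size xs); last by exists set0.
  have [s [t [s01 t01 st sE]]] := hxs _ (mem_nth 0 ixs).
  exists [set (e, s); (f, t)] => _; split; last by exists s, t.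
  by exists s, t; split=> //; move=> [].
apply/card_subP; exists (c @` `I_(size xs)).
  apply: inj_card_eq => i j; rewrite !inE => /= ixs jxs cE.
  have [_ [s [t [ci si]]]] := cP _ ixs.
  have [_ [s' [t' [cj sj]]]] := cP _ jxs.
  (* As [e <> f], a crossing determines its parameter on [e], hence its abscissa. *)
  have : [set (e, s'); (f, t')] (e, s) by rewrite -cj -cE ci; left.
  case=> [[ss]|[] //]; apply/eqP; rewrite -(nth_uniq 0 ixs jxs uxs).
  by rewrite -si -sj ss.
by move=> _ [i ixs <-]; have [] := cP _ ixs.
Qed.

(** The homotopy interpolates abscissae linearly and stays on the vertical segment between the two
    graphs. At a vertex other than the ends both graphs pass on the same side, so the segment misses
    it. *)
Lemma same_word_homotopic e f (a : edge_graph D e) (b : edge_graph D f) :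
  letter a =1 letter b -> parallel e f /\ homotopic D e f.
Proof.
move=> ab.
have par : ends e = ends f.
  by apply/setP => v; rewrite (ends_letter a) (ends_letter b) ab.
(* Left ends lie strictly left of right ends, so equal end sets cannot be matched crosswise. *)
have [lE rE] : left_end a = left_end b /\ right_end a = right_end b.
  have := graph_ends a; rewrite par (graph_ends b) => /setP ends_ab.
  have := left_lt_right a; have := left_lt_right b.
  have := ends_ab (left_end b); have := ends_ab (right_end b).
  rewrite !inE !eqxx orbT /= => /esym/orP[]/eqP-> /esym/orP[]/eqP-> h1 h2;
    by split=> //; exfalso; move: h1; rewrite ?ltxx// ltNge ltW.
split=> //.
pose X (p : R * R) : R := (1 - p.1) * graph_x a p.2 + p.1 * graph_x b p.2.
pose Y (p : R * R) : R := (1 - p.1) * graph_y a (X p) + p.1 * graph_y b (X p).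
(* Both graphs run left to right; [orient] restores the direction of [curve D e]. *)
pose H (p : R * R) : R * R :=
  (X (p.1, orient (reversed a) p.2), Y (p.1, orient (reversed a) p.2)).
have H0 (t : R) : 0 <= t <= 1 -> H (0, t) = curve D e t.
  move=> t01; rewrite /H /Y /X /= !subr0 !mul1r !mul0r !addr0.
  by rewrite -graph_curve ?orient_cc// orientK.
have H1 (t : R) : 0 <= t <= 1 ->
    H (1, t) = curve D f (orient (reversed b) (orient (reversed a) t)).
  move=> t01; rewrite /H /Y /X /= !subrr !mul1r !mul0r !add0r.
  by rewrite -graph_curve ?orient_cc.
have Xl s : X (s, 0) = px (left_end a).
  by rewrite /X /= !graph_x0 lE; ring.
have Xr s : X (s, 1) = px (right_end a).
  by rewrite /X /= !graph_x1 rE; ring.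
have Yl s t : X (s, t) = px (left_end a) -> Y (s, t) = py (left_end a).
  move=> XE; rewrite /Y XE.
  have -> : graph_y a (px (left_end a)) = py (left_end a).
    by rewrite -[in RHS](graph_left_xy a).
  have -> : graph_y b (px (left_end a)) = py (left_end a).
    by rewrite lE -[in RHS](graph_left_xy b).
  by rewrite /=; ring.
have Yr s t : X (s, t) = px (right_end a) -> Y (s, t) = py (right_end a).
  move=> XE; rewrite /Y XE.
  have -> : graph_y a (px (right_end a)) = py (right_end a).
    by rewrite -[in RHS](graph_right_xy a).
  have -> : graph_y b (px (right_end a)) = py (right_end a).
    by rewrite rE -[in RHS](graph_right_xy b).
  by rewrite /=; ring.
have pairE (p : R * R) v : p.1 = px v -> p.2 = py v -> p = vpoint D v.
  by move=> p1 p2; apply: injective_projections.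
exists H; split.
- apply: continuous_subspaceT.
  have fstc : continuous (fst : R * R -> R) by move=> p; exact: cvg_fst.
  have sndc : continuous (snd : R * R -> R) by move=> p; exact: cvg_snd.
  have onec : continuous (fun p : R * R => 1 - p.1).
    by move=> p; apply: continuousB; [exact: cst_continuous|exact: fstc].
  have blend (k1 k2 : R * R -> R) : continuous k1 -> continuous k2 ->
      continuous (fun p : R * R => (1 - p.1) * k1 p + p.1 * k2 p : R).
    move=> c1 c2 p; apply: (@continuousD _ _ _
      (fun p : R * R => (1 - p.1) * k1 p : R)
      (fun p : R * R => p.1 * k2 p : R)); apply: continuousM;
      [exact: onec|exact: c1|exact: fstc|exact: c2].
  have Xc : continuous X.
    by apply: blend => p; apply: (@continuous_comp _ _ _ snd);
      [exact: sndc|exact: graph_x_continuous|exact: sndc|exact: graph_x_continuous].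
  have Yc : continuous Y.
    by apply: blend => p; apply: (@continuous_comp _ _ _ X);
      [exact: Xc|exact: graph_y_continuous|exact: Xc|exact: graph_y_continuous].
  have oc : continuous (fun p : R * R => (p.1, orient (reversed a) p.2)).
    apply: continuous_pair => // p.
    by apply: (@continuous_comp _ _ _ snd); [exact: sndc|exact: orient_continuous].
  apply: continuous_pair => p.
    by apply: (continuous_comp (oc p)); exact: Xc.
  by apply: (continuous_comp (oc p)); exact: Yc.
- exact: H0.
- have [ra|ra] := eqVneq (reversed a) (reversed b).
    by left=> t t01; rewrite H1// ra orientK.
  right=> t t01; rewrite H1//; congr (curve D f _).
  by case: (reversed a) (reversed b) ra => [] [] //=; rewrite opprB addrC subrK.
- move=> s s01; rewrite -!H0 ?lexx ?ler01// /H /=.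
  suff ho t : t = 0 \/ t = 1 ->
      (X (s, t), Y (s, t)) = (X (0, t), Y (0, t)).
    by split; apply: ho; rewrite /orient; case: (reversed a);
      rewrite ?subr0 ?subrr; tauto.
  by case=> ->; rewrite !(Xl, Xr); rewrite ?(Yl _ _ (Xl _)) ?(Yr _ _ (Xr _)).
- move=> s t s01 t01 v ve; rewrite /H /=.
  have : 0 <= orient (reversed a) t <= 1 by rewrite orient_cc.
  move: (orient _ t) => {}t {}t01 HE.
  have {HE}[HX HY] : X (s, t) = px v /\ Y (s, t) = py v by rewrite -HE.
  have Xab : px (left_end a) <= X (s, t) <= px (right_end a).
    have := graph_x_itv a t01; have := graph_x_itv b t01.
    rewrite -lE -rE /X /=; move: (graph_x a t) (graph_x b t) => x y.
    by move=> /andP[? ?] /andP[? ?]; case/andP: s01 => ? ?; apply/andP; split; nra.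
  have notend w : vpoint D v = vpoint D w -> w \in ends e -> False.
    by move=> /vpoint_inj vw we; rewrite vw we in ve.
  (* On the vertical line through an end the homotopy stays at that end, which [v] is not. *)
  have [vl|vl] := eqVneq (px v) (px (left_end a)).
    apply: (notend (left_end a)); last by rewrite (graph_ends a) !inE eqxx.
    by apply: pairE => //; rewrite -HY (@Yl s t)// HX.
  have [vr|vr] := eqVneq (px v) (px (right_end a)).
    apply: (notend (right_end a)); last by rewrite (graph_ends a) !inE eqxx orbT.
    by apply: pairE => //; rewrite -HY (@Yr s t)// HX.
  have va : in_range a v.
    apply: in_range_oo; rewrite !lt_neqAle (eq_sym _ (px v)) vl vr /=.
    by rewrite -HX.
  have vb : in_range b v.
    apply: in_range_oo; rewrite -lE -rE !lt_neqAle (eq_sym _ (px v)) vl vr /=.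
    by rewrite -HX.
  have na : letter a v <> Some 1%N by apply/eqP; rewrite -ends_letter.
  have := ab v; move: na; rewrite /letter va vb.
  move: HY; rewrite /Y /= HX.
  move: (graph_y a _) (graph_y b _) => y z.
  case: (ltgtP y) => // hy; case: (ltgtP z) => // hz HY _ _.
    by have := convex_lt s01 hy hz; rewrite HY ltxx.
  (* When both graphs pass above [v], the same argument applies after negation. *)
  have := @convex_lt _ s (- y) (- z) (- py v) s01.
  by rewrite !ltrN2 !mulrN -opprD HY ltxx => /(_ hy hz).
Qed.

End Words.

(** * Bounding sets of edges, and double counting *)

Section EdgeSets.
Variables (R : realType) (G : multigraph) (D : drawing R G).
Hypotheses (monoD : x_monotone D) (nonhomD : non_homotopic D).

Lemma edge_set_bound (k : nat) (F : {set edge G}) :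
  (k < #|vertex G|)%N ->
  {in F &, forall e f, e <> f -> cross_at_most D k e f} ->
  (#|F| <= 2 * 'C(2 * #|vertex G|, k + 1))%N.
Proof.
move=> ltkn crF.
pose gr e : edge_graph D e := projT1 (cid (edge_graph_exists monoD e)).
pose vs := sort (vle D) (enum (vertex G)).
have vs_mem v : v \in vs by rewrite mem_sort mem_enum.
have vs_le : pairwise (vle D) vs.
  rewrite -sorted_pairwise; last exact: vle_trans.
  by apply: sort_sorted; exact: vle_total.
have vs_uniq : uniq vs by rewrite sort_uniq enum_uniq.
pose word e := [seq letter (gr e) v | v <- vs].
have word_inj : injective word.
  move=> e f /eq_in_map ef; apply: contrapT => neq.
  have [|par hom] := @same_word_homotopic _ _ _ _ _ (gr e) (gr f).
    by move=> v; apply: ef.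
  exact: nonhomD neq par hom.
rewrite cardE -(size_map word) addn1.
(* Here [d] is [k + 1]: alternating [k + 2] times would force [k + 1] crossings. *)
apply: leq_trans (word_bound_bin _); last by rewrite /= ltkn.
apply: word_count => //.
- by rewrite map_inj_uniq// enum_uniq.
- by move=> _ /mapP[e _ ->]; rewrite size_map size_sort -cardE.
- by move=> _ /mapP[e _ ->]; rewrite waiting_word ?orbT.
- move=> _ _ s /mapP[e + ->] /mapP[f + ->]; rewrite !mem_enum => eF fF.
  apply/negP; have [<-|/eqP ef] := eqVneq e f.
    by rewrite alternatesxx.
  move=> /(alternates_crosses vs_le)[v [xs [_ _ sz pxs hxs]]].
  have xs_uniq : uniq xs by exact: lt_sorted_uniq (path_sorted pxs).
  by have := crosses_le ef (crF _ _ eF fF ef) xs_uniq hxs; rewrite sz ltnn.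
Qed.

Lemma card_ends_eq2 (e : edge G) : #|ends e| = 2.
Proof.
have [a _] := cid (edge_graph_exists monoD e).
by rewrite (graph_ends a) cards2 left_right.
Qed.

Lemma sum_incident :
  (\sum_v #|[set e : edge G | v \in ends e]%SET| = 2 * #|edge G|)%N.
Proof.
under eq_bigr do rewrite -sum1dep_card.
rewrite (exchange_big_dep xpredT)//=.
under eq_bigr do rewrite sum1_card card_ends_eq2.
by rewrite sum_nat_const mulnC.
Qed.

Lemma sum_parallel : (\sum_(A : {set vertex G} | #|A| == 2)
  #|[set e : edge G | ends e == A]%SET| = #|edge G|)%N.
Proof.
under eq_bigr do rewrite -sum1dep_card.
rewrite (exchange_big_dep xpredT)// -sum1_card; apply: eq_bigr => e _.
rewrite (big_pred1 (ends e)) // => A; rewrite [RHS]eq_sym.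
by have [<-|_] := eqVneq (ends e) A; rewrite ?andbF// card_ends_eq2.
Qed.

End EdgeSets.

End Geometry.

Theorem theorem2 (R : realType) (k n : nat) (G : multigraph) (D : drawing R G)
    (ltkn : k < n) (cardV : #|vertex G| = n)
    (monoD : x_monotone D) (nonhomD : non_homotopic D) :
  [/\ (forall e f : edge G, e <> f -> cross_at_most D k e f) ->
        #|edge G| <= 2 * 'C(2 * n, k + 1),
      (forall e f : edge G, e <> f -> incident e f -> cross_at_most D k e f) ->
        #|edge G| <= n * 'C(2 * n, k + 1) &
      (forall e f : edge G, e <> f -> parallel e f -> cross_at_most D k e f) ->
        #|edge G| <= n * (n - 1) * 'C(2 * n, k + 1)].
Proof.
subst n; split=> crE.
- rewrite -cardsT; apply: (edge_set_bound monoD nonhomD ltkn) => e f _ _.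
  exact: crE.
(* Each edge is counted at both of its ends, and the edges at one vertex are pairwise incident. *)
- rewrite -(leq_pmul2l (isT : 0 < 2)) -(sum_incident monoD).
  rewrite mulnCA -sum_nat_const; apply: leq_sum => v _.
  apply: (edge_set_bound monoD nonhomD ltkn) => e f.
  by rewrite !inE => ve vf ef; apply: crE => //; exists v.
(* There is one parallel class per pair of vertices, and n(n-1) is twice the number of pairs. *)
- rewrite -(sum_parallel monoD) subn1.
  have -> : #|vertex G| * #|vertex G|.-1 = 'C(#|vertex G|, 2) * 2.
    by have := bin_ffact #|vertex G| 2; rewrite ffactnS ffactn1.
  rewrite -mulnA -card_draws -sum_nat_const.
  rewrite [leqRHS](eq_bigl _ _ (finset.in_set _)); apply: leq_sum => A _.
  apply: (edge_set_bound monoD nonhomD ltkn) => e f.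
  by rewrite !inE => /eqP eA /eqP fA ef; apply: crE => //; rewrite /parallel eA.
Qed.
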